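(* Let $t\ge1$, $G=\mathbb{Z}_{4t+2}$, and let $\psi=\gamma\prod_{j=1}^w\partial_{i_j}$ where $i_1,\ldots,i_w$ are distinct elements of $\{2,\ldots,4t+1\}$. If $\psi$ is quasi-orthogonal then $t\le w\le 3t+1$.
   Context: Index the elements $0,1,\ldots,4t+1$ of $G$ by $1,\ldots,4t+2$. $\gamma(j,k)=(-1)^{\lfloor (j+k)/(4t+2)\rfloor}$ for $j,k\in\{0,\ldots,4t+1\}$. For $2\le i\le 4t+2$, $\partial_i(x,y)=\delta_i(x)\delta_i(y)\delta_i(x+y)$ where $\delta_i:G\to\{\pm1\}$ is $-1$ at the element with index $i$ (i.e. $i-1$) and $1$ elsewhere. Products of cocycles are pointwise. For a normalized cocycle $\psi$ with matrix $M_\psi=[\psi(g,h)]$, $RE(M_\psi)=\sum_{g\ne0}|\sum_h\psi(g,h)|$; since $\psi$ here is not a coboundary, it is quasi-orthogonal iff $RE(M_\psi)=4t$. *)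

(* Defs.v *)
From mathcomp Require Import all_boot all_order all_algebra.

Set Implicit Arguments.
Unset Strict Implicit.
Unset Printing Implicit Defensive.

Import Order.TTheory GRing.Theory Num.Theory.
Local Open Scope ring_scope.

Section Cocycles.
Variable G : finZmodType.
Implicit Types (psi : G -> G -> int) (phi : G -> int).

Definition sign_valued (T : Type) (f : T -> int) := forall x, f x = 1 \/ f x = -1.

Definition normalized_cocycle psi :=
  [/\ forall x, sign_valued (psi x),
      forall x, psi x 0 = 1 /\ psi 0 x = 1
    & forall x y z, psi x y * psi (x + y) z = psi x (y + z) * psi y z].

(* phi^-1 = phi for values in {1, -1}. *)
Definition cobound phi : G -> G -> int := fun x y => phi x * phi y * phi (x + y).

Definition is_coboundary psi :=
  exists2 phi : G -> int, sign_valued phi & forall x y, psi x y = cobound phi x y.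

Definition row_excess psi : int := \sum_(g : G | g != 0) `|\sum_(h : G) psi g h|.

(* Meaningful when #|G| = 4t+2: the row excess of a normalized cocycle is at
   least 4t, and at least 8t+2 for a coboundary; quasi-orthogonal cocycles are
   those that meet the relevant bound. *)
Definition quasi_orthogonal (t : nat) psi :=
  [/\ normalized_cocycle psi,
      is_coboundary psi -> row_excess psi = (8 * t + 2)%N
    & ~ is_coboundary psi -> row_excess psi = (4 * t)%N].

End Cocycles.

(* The nat coercion of an element of 'Z_n is its representative in 0..n-1, so
   j + k below is the sum in nat. *)
Definition gamma (n : nat) : 'Z_n -> 'Z_n -> int :=
  fun j k => (-1) ^+ ((j + k)%N %/ n).

(* Elements are indexed from 1: the element x has index x.+1. *)
Definition delta (n i : nat) : 'Z_n -> int :=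
  fun x => if x.+1 == i then -1 else 1.

Definition elem_cobound (n i : nat) : 'Z_n -> 'Z_n -> int := cobound (delta i).

Definition gamma_prod (n w : nat) (i : 'I_w -> nat) : 'Z_n -> 'Z_n -> int :=
  fun x y => gamma x y * \prod_(j < w) elem_cobound (i j) x y.

(* Main.v *)
Require Import Defs.
From mathcomp Require Import all_boot all_order all_algebra.
From mathcomp Require Import zify.

Set Implicit Arguments.
Unset Strict Implicit.
Unset Printing Implicit Defensive.

Import Order.TTheory GRing.Theory Num.Theory.
Local Open Scope ring_scope.

(** Let [n = 4t+2], write [psi = gamma * cobound phi], and let [r g] be the sum
    of row [g].  The product of row [g] is [(-1)^g]; since the row has [4t+2]
    entries, [r g] is congruent to [2] modulo [4] when [g] is even.  The [2t]
    nonzero even rows therefore already contribute [4t] to the row excess, so a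
    row excess of [4t] forces [r 1 = 0].  (The product of row [1] also shows that
    [psi] is not a coboundary.)  Summing the inequalities
    [a * b >= a + b - 1] and [a * b >= - a - b - 1], valid for signs, over
    [a = phi h], [b = phi (h+1)], and correcting for [h = n-1], where [gamma 1 h]
    is [-1] and both signs are [1], bounds the sum [n - 2w] of [phi] on both
    sides. *)

Section SignSums.
Variable T : finType.
Implicit Types f : T -> int.

Definition minus_count f : nat := #|[pred x | f x == -1]|.

Lemma sum_sign f : sign_valued f ->
  \sum_x f x = #|T|%:Z - (minus_count f).*2%:Z.
Proof.
move=> sf; rewrite (eq_bigr (fun x => 1 - 2 * (f x == -1)%:R)); last first.
  by move=> x _; case: (sf x) => ->.
have <- : (\sum_x (f x == -1)%R = minus_count f)%N.
  by rewrite /minus_count -sum1_card [RHS]big_mkcond.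
by rewrite sumrB -mulr_sumr sumr_const -natr_sum !natz -mul2n PoszM.
Qed.

Lemma prod_sign f : sign_valued f -> \prod_x f x = (-1) ^+ minus_count f.
Proof.
move=> sf; rewrite (bigID (fun x => f x == -1)) /= [X in _ * X]big1 ?mulr1.
  rewrite (eq_bigr (fun=> -1)) => [|x /eqP //].
  by rewrite prodr_const.
by move=> x; case: (sf x) => ->.
Qed.

End SignSums.

Section GammaProd.
Variables (n w : nat) (i : 'I_w -> nat).
Implicit Types g h x : 'Z_n.

Definition delta_prod x : int := \prod_(j < w) delta (i j) x.

Lemma gamma_prodE g h :
  gamma_prod i g h = gamma g h * cobound delta_prod g h.
Proof. by rewrite /gamma_prod /cobound /delta_prod -!big_split. Qed.

(** As the indices are distinct, at most one factor is -1 at [x]. *)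
Lemma delta_prodE x : injective i ->
  delta_prod x = if x.+1 \in codom i then -1 else 1.
Proof.
move=> inj_i; case: ifP => [/codomP[j xj] | xi].
  rewrite /delta_prod (bigD1 j) //= big1 ?mulr1 /delta ?xj ?eqxx // => k kj.
  by rewrite (inj_eq inj_i) eq_sym (negPf kj).
rewrite /delta_prod big1 // => j _; rewrite /delta; case: eqP => // xj.
by rewrite xj codom_f in xi.
Qed.

Lemma delta_prod_sign : injective i -> sign_valued delta_prod.
Proof. by move=> inj_i x; rewrite delta_prodE //; case: ifP; [right | left]. Qed.

End GammaProd.

(** Translation by [g] permutes the group, so the factors [phi h] and [phi (g + h)] cancel over the
    whole row and only the constant factor [phi g] remains. *)
Lemma prod_row_cobound (G : finZmodType) (phi : G -> int) g :
  sign_valued phi -> \prod_h cobound phi g h = phi g ^+ #|G|.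
Proof.
move=> sphi; rewrite /cobound.
rewrite big_split /= [X in _ * X](_ : _ = \prod_h phi h); last first.
  by rewrite [RHS](reindex_inj (addrI g)).
rewrite big_split /= prodr_const -mulrA -big_split /= big1 ?mulr1 // => h _.
by case: (sphi h) => ->.
Qed.

Section EvenOrder.
Variable m : nat.
(** The double successor lets ['Z_n] compute to an ordinal type of size n. The theorem takes m =
    2t. *)
Let n := m.*2.+2.
Implicit Types g h x : 'Z_n.

Lemma card_Zn : #|'Z_n| = (2 * m.+1)%N.
Proof. by rewrite card_ord mul2n. Qed.

(* The carries [(g + h) %/ n] of row [g] sum to [g]: by Euclidean division
   their sum times [n] is [\sum_h (g + h) - \sum_h (g + h) %% n], and the
   remainders are a permutation of the [h]. *)
Lemma sum_carry g : (\sum_(h : 'Z_n) (g + h)%N %/ n = g)%N.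
Proof.
have : (\sum_(h : 'Z_n) (g + h) = \sum_(h : 'Z_n) ((g + h) %/ n * n + h))%N.
  rewrite (eq_bigr (fun h : 'Z_n => (g + h) %/ n * n + (g + h) %% n)%N);
    last by move=> h _; exact: divn_eq.
  rewrite !big_split /=; congr addn.
  by rewrite [RHS](reindex_inj (addrI g)).
rewrite !big_split /= -big_distrl /= => /addIn.
rewrite sum_nat_const card_ord mulnC => /eqP.
by rewrite eqn_pmul2r // => /eqP.
Qed.

Lemma prod_row_gamma g : \prod_h gamma g h = (-1) ^+ (g : nat).
Proof. by rewrite -[in RHS](sum_carry g) -prodrXr. Qed.

Lemma prod_row_gamma_cobound phi g : sign_valued phi ->
  \prod_h (gamma g h * cobound phi g h) = (-1) ^+ (g : nat).
Proof.
move=> sphi; rewrite big_split /= prod_row_gamma prod_row_cobound // card_Zn exprM.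
by case: (sphi g) => ->; rewrite ?sqrrN !expr1n mulr1.
Qed.

Lemma gamma_cobound_not_coboundary phi : sign_valued phi ->
  ~ is_coboundary (fun g h : 'Z_n => gamma g h * cobound phi g h).
Proof.
move=> sphi [f sf fE].
have := prod_row_gamma_cobound (1 : 'Z_n) sphi.
rewrite (eq_bigr _ (fun h _ => fE 1 h)) prod_row_cobound // card_Zn exprM.
by case: (sf 1) => ->; rewrite ?sqrrN !expr1n.
Qed.

Lemma gamma_cobound_sign phi g : sign_valued phi ->
  sign_valued (fun h : 'Z_n => gamma g h * cobound phi g h).
Proof.
move=> sphi h; rewrite /gamma /cobound -signr_odd.
by case: (sphi g) => ->; case: (sphi h) => ->; case: (sphi (g + h)) => ->;
  case: odd; rewrite ?expr0 ?expr1; [right|left|left|right|left|right|right|left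
    |left|right|right|left|right|left|left|right].
Qed.

(** The row product is 1, so the number c of entries -1 is even; as m is even, the row sum 2(m + 1 -
    c) is twice an odd number. *)
Lemma even_row_sum_ge2 phi g : ~~ odd m -> sign_valued phi -> ~~ odd g ->
  2 <= `|\sum_(h : 'Z_n) gamma g h * cobound phi g h|.
Proof.
move=> em sphi eg; have srow := gamma_cobound_sign g sphi.
have := prod_sign srow; rewrite prod_row_gamma_cobound // sum_sign // card_Zn.
move: (minus_count _) => c; rewrite -[LHS]signr_odd -[RHS]signr_odd (negPf eg).
by case: (boolP (odd c)) => // ec _; lia.
Qed.

Lemma card_even_nonzero : #|[pred g : 'Z_n | (g != 0) && ~~ odd g]| = m.
Proof.
rewrite -sum1_card /= big_mkcond /=.
(* Once 0 is split off, [k] stands for the element k + 1, so the even elements are counted by the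
   odd [k]. *)
rewrite (@big_ord_recl _ _ _ m.*2.+1) /= add0n.
rewrite (eq_bigr (fun k : 'I_m.*2.+1 => (odd k : nat))); last first.
  by move=> k _; rewrite inE /= /bump /= negbK; case: odd.
rewrite -(big_mkord xpredT (fun k => odd k : nat)).
elim: m => [|k IHk]; first by rewrite big_nat1.
rewrite doubleS !big_nat_recr //= odd_double.
by rewrite big_nat_recr //= in IHk; lia.
Qed.

Lemma row1_sum_eq0 phi : ~~ odd m -> sign_valued phi ->
  row_excess (fun g h : 'Z_n => gamma g h * cobound phi g h) = m.*2 ->
  \sum_(h : 'Z_n) gamma 1 h * cobound phi 1 h = 0.
Proof.
move=> em sphi; rewrite /row_excess (bigID (fun g : 'Z_n => odd g)) /=.
rewrite (bigD1 (1 : 'Z_n)) //=.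
(* [a] comes from row 1, [b] from the other odd rows, [c] from the nonzero even rows; [c] alone
   exhausts the excess 2m. *)
set a := `|_|; set b := \sum_(_ | _ && _) _; set c := \sum_(_ | _ && _) _.
have b0 : 0 <= b by apply: sumr_ge0.
have c0 : m.*2%:Z <= c.
  rewrite -[X in X.*2]card_even_nonzero.
  apply: le_trans (_ : \sum_(g : 'Z_n | (g != 0) && ~~ odd g) (2 : int) <= c).
    by rewrite sumr_const -[_ *+ #|_|]mulr_natr [#|_|%:R]natz -mul2n PoszM.
  by apply: ler_sum => g /andP[_ eg]; exact: even_row_sum_ge2.
move=> e; apply/eqP; rewrite -normr_eq0 -/a.
have : 0 <= a by exact: normr_ge0.
lia.
Qed.

Lemma sum_bounds_of_row1 phi : sign_valued phi ->
    phi 0 = 1 -> phi (- 1) = 1 ->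
    \sum_(h : 'Z_n) gamma 1 h * cobound phi 1 h = 0 ->
  - m%:Z <= \sum_h phi h <= m%:Z + 2.
Proof.
move=> sphi p0 p1 r0.
have {}r0 : \sum_h gamma 1 h * (phi h * phi (1 + h)) = 0.
  apply: (@mulfI _ (phi 1)); first by case: (sphi 1) => ->.
  rewrite mulr0 -[RHS]r0 mulr_sumr; apply: eq_bigr => h _.
  by rewrite /cobound mulrCA !mulrA.
(* In row 1 a carry occurs only at h = n - 1, the element -1. *)
have gE h : gamma 1 h = if h == -1 then -1 else 1.
  rewrite /gamma -[nat_of_ord 1]/1%N add1n.
  have -> : (h == -1) = (h.+1 == n :> nat).
    by rewrite -val_eqE /= modn_small ?subn1.
  case: eqP => [->|/eqP hn]; first by rewrite divnn.
  by rewrite divn_small ?expr0 // ltn_neqAle hn ltn_ord.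
have shift : \sum_h phi (1 + h) = \sum_h phi h.
  by rewrite [RHS](reindex_inj (addrI 1)).
have card_n : \sum_(h : 'Z_n) (1 : int) = n%:Z.
  by rewrite sumr_const card_ord natz.
have last1 : \sum_(h : 'Z_n) ((h == -1)%:R : int) = 1.
  by rewrite (bigD1 (-1)) //= eqxx big1 // => h /negPf ->.
set s := \sum_h phi h in shift *.
apply/andP; split.
(* At h = -1 the uncorrected summand is -3 and the entry is -1; adding 2 sharpens the bound to s >=
   -m. *)
- have : \sum_h (- phi h - phi (1 + h) - 1 + 2 * (h == -1)%:R) <= (0 : int).
    rewrite -[leRHS]r0; apply: ler_sum => h _; rewrite gE.
    case: eqP => [->|_]; first by rewrite subrr p0 p1.
    by case: (sphi h) => ->; case: (sphi (1 + h)) => ->.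
  rewrite big_split sumrB sumrB sumrN -mulr_sumr shift card_n last1 /n -/s /=; lia.
(* Here the uncorrected summand at h = -1 would be 1, above the entry -1. *)
- have : \sum_h (phi h + phi (1 + h) - 1 - 2 * (h == -1)%:R) <= (0 : int).
    rewrite -[leRHS]r0; apply: ler_sum => h _; rewrite gE.
    case: eqP => [->|_]; first by rewrite subrr p0 p1.
    by case: (sphi h) => ->; case: (sphi (1 + h)) => ->.
  rewrite sumrB sumrB big_split -mulr_sumr shift card_n last1 /n -/s /=; lia.
Qed.

End EvenOrder.

(** The elements with value -1 are the images of the injection sending [j] to the element of index
    [i j]. *)
Lemma minus_count_delta_prod (k w : nat) (i : 'I_w -> nat) : injective i ->
    (forall j, 0 < i j <= k.+2)%N ->
  minus_count (@delta_prod k.+2 w i) = w.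
Proof.
move=> inj_i i_bd; rewrite -[RHS]card_ord.
have inj_f : injective (fun j => inord (i j).-1 : 'I_k.+2).
  move=> j l /(congr1 val) /=; have := i_bd j; have := i_bd l => bl bj.
  by rewrite !inordK; [move=> e; apply: inj_i; lia | lia | lia].
rewrite -(card_codom inj_f); apply: eq_card => x; rewrite inE delta_prodE //.
apply/idP/codomP => [|[j ->]].
  case: ifP => // /codomP[j xj] _; exists j; apply: val_inj => /=.
  by rewrite -xj inordK /= ?ltn_ord.
have bj := i_bd j; have lt_j : ((i j).-1 < k.+2)%N by lia.
rewrite (inordK lt_j) prednK ?codom_f //; lia.
Qed.

Local Close Scope ring_scope.

Theorem corollary2 (t : nat) (ht : 1 <= t) (w : nat) (i : 'I_w -> nat)
    (hinj : injective i) (hi : forall j, 2 <= i j <= 4 * t + 1) :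
  quasi_orthogonal t (@gamma_prod (4 * t).+2 w i) -> t <= w <= 3 * t + 1.
Proof.
have n4 : 4 * t = t.*2.*2 by lia.
have i_bd j : 0 < i j <= (4 * t).+2 by have := hi j; lia.
have count_w := minus_count_delta_prod hinj i_bd.
rewrite n4 in count_w *; set phi := @delta_prod _ w i in count_w.
have sphi : sign_valued phi by exact: delta_prod_sign.
case=> _ _; rewrite n4 => noncob.
have excess : row_excess (fun g h => gamma g h * cobound phi g h)%R = t.*2.*2.
  rewrite -noncob => [|[f sf fE]].
    by apply: eq_bigr => g _; congr `|_|%R; apply: eq_bigr => h _;
       rewrite gamma_prodE.
  apply: (gamma_cobound_not_coboundary sphi); exists f => // g h.
  by rewrite -fE gamma_prodE.
(* The elements 0 and n - 1 have indices 1 and 4t + 2, which [hi] excludes. *)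
have phi1 (x : 'Z_t.*2.*2.+2) :
    (x == 0 :> nat) || (x == t.*2.*2.+1 :> nat) -> phi x = 1%R.
  move=> x_end; rewrite /phi delta_prodE //; case: ifP => // /codomP[j xj].
  by have := hi j; rewrite -xj; lia.
have em : ~~ odd t.*2 by rewrite odd_double.
have row1 := row1_sum_eq0 em sphi excess.
have phi_m1 : phi (- 1)%R = 1%R.
  by apply: phi1; rewrite /= modn_small ?subn1 ?eqxx ?orbT.
have := sum_bounds_of_row1 sphi (phi1 0%R isT) phi_m1 row1.
(* The bounds now read -2t <= 4t + 2 - 2w <= 2t + 2. *)
rewrite sum_sign // count_w card_ord -[Zp_trunc _]/(t.*2.*2); lia.
Qed.
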